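(* The following asymptotics hold for the stationary blocking probability $\pi_K(K,K)$ of the symmetric join-the-shortest-queue system with two queues of capacity $K\ge1$ and parameter $\rho>0$. For fixed $K$, $$\pi_K(K,K)=\begin{cases}2\rho^{2K}+O(\rho^{2K+1}) & \text{as }\rho\to0,\\ 1-1/\rho+O(\rho^{-(K+1)}) & \text{as }\rho\to+\infty.\end{cases}$$ For fixed $\rho$, as $K$ tends to $+\infty$, $$\pi_K(K,K)=\begin{cases}\rho^{2K}(1-\rho)(2-\rho)+O\big((\rho^3/2)^K\big) & \text{if }\rho<1/2,\\ \rho^{2K}(1-\rho)(2-\rho)+O(\rho^{4K}) & \text{if }1/2\le\rho<1,\\ (2K)^{-1}+O(K^{-2}2^{-K}) & \text{if }\rho=1,\\ 1-1/\rho+O(\rho^{-2K}) & \text{if }1<\rho<2,\\ 1/2+O(K\,2^{-2K}) & \text{if }\rho=2,\\ 1-1/\rho+O\big((2\rho)^{-K}\big) & \text{if }\rho>2.\end{cases}$$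
   Context: Symmetric finite-capacity JSQ model: two one-server queues, each of capacity $K$; service times are exponential with parameter $1$ at both queues; customers arrive according to a Poisson process with parameter $2\rho$ and join the shortest queue, or either queue with probability $1/2$ if both lengths are equal; when both queues have length $K$ arriving customers are lost. The queue-length process $(L_1(t),L_2(t))_{t\ge0}$ is the continuous-time Markov chain on $\{0,\dots,K\}^2$ with the following transition rates ($e_1,e_2$ the unit vectors). From $(k,k)$: to $(k,k)+e_1$ and to $(k,k)+e_2$ at rate $\rho$ each if $k<K$; to $(k,k)-e_1$ and to $(k,k)-e_2$ at rate $1$ each if $k>0$. From $(j,k)$ with $j<k$: to $(j+1,k)$ at rate $2\rho$, to $(j-1,k)$ at rate $1$ if $j>0$, to $(j,k-1)$ at rate $1$. From $(k,j)$ with $j<k$: to $(k,j+1)$ at rate $2\rho$, to $(k,j-1)$ at rate $1$ if $j>0$, to $(k-1,j)$ at rate $1$. The chain is irreducible, and $\pi_K$ denotes its unique invariant probability distribution. *)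

(* Defs.v *)
From HB Require Import structures.
From mathcomp Require Import all_boot all_order all_algebra.
From mathcomp Require Import all_classical all_reals all_analysis.

Set Implicit Arguments.
Unset Strict Implicit.
Unset Printing Implicit Defensive.

Import Order.TTheory GRing.Theory Num.Theory.
Import numFieldNormedType.Exports.

Local Open Scope ring_scope.

(* Allows the Landau notations at +oo. *)
Canonical pinfty_filter_on (R : realType) :=
  FilterType (pinfty_nbhs R) _.

Section FiniteMarkovChain.
Context {R : realType} {T : finType}.
Implicit Types (q : T -> T -> R) (x p : {ffun T -> R}).

(* Only the off-diagonal values of the rates q are used. *)
Definition generator q (s t : T) : R :=
  if s == t then - \sum_(u | u != s) q s u else q s t.

Definition stationary q x : Prop :=
  forall t, \sum_s x s * generator q s t = 0.

Definition invariant_distribution q p : Prop :=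
  [/\ forall s, 0 <= p s, \sum_s p s = 1 & stationary q p].

Definition irreducible_rates q : Prop :=
  forall s t, connect [rel u v | 0 < q u v] s t.

(* A distribution only when an invariant one exists; see invariant_lawP, jsq_piP. *)
Definition invariant_law q : {ffun T -> R} :=
  xget [ffun=> 0] [set p | invariant_distribution q p]%classic.

Lemma generator_row0 q s : \sum_t generator q s t = 0.
Proof.
rewrite (bigD1 s) //= {1}/generator eqxx addrC; apply/eqP.
rewrite subr_eq0; apply/eqP/eq_bigr => t ts.
by rewrite /generator eq_sym (negbTE ts).
Qed.

Lemma stationary_exists q : (0 < #|T|)%N ->
  exists2 x, stationary q x & exists s, x s != 0.
Proof.
move=> T0.
pose A : 'M[R]_#|T| := \matrix_(i, j) generator q (enum_val i) (enum_val j).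
have A1 : A *m (const_mx 1 : 'cV_#|T|) = 0.
  apply/colP => i; rewrite !mxE.
  under eq_bigr => j _ do rewrite !mxE mulr1.
  rewrite -[RHS](generator_row0 q (enum_val i)).
  by rewrite [RHS](reindex (@enum_val _ T)) //; apply/onW_bij/enum_val_bij.
have : \det A == 0.
  rewrite -det_tr; apply/det0P; exists (const_mx 1 : 'rV_#|T|).
    apply/eqP => /rowP /(_ (Ordinal T0)); rewrite !mxE => /eqP.
    by rewrite oner_eq0.
  by apply: trmx_inj; rewrite trmx_mul trmxK trmx_const A1 trmx0.
move=> /det0P[v v0 vA].
exists [ffun s => v 0 (enum_rank s)].
  move=> t; move/rowP/(_ (enum_rank t)): vA; rewrite !mxE => vAt; rewrite -[RHS]vAt.
  rewrite [LHS](reindex (@enum_val _ T)); last exact/onW_bij/enum_val_bij.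
  by apply: eq_bigr => i _; rewrite ffunE !mxE enum_valK enum_rankK.
have /rV0Pn[i vi] := v0.
by exists (enum_val i); rewrite ffunE enum_valK.
Qed.

Lemma stationary_norm q x : (forall s t, 0 <= q s t) ->
  stationary q x -> stationary q [ffun s => `|x s|].
Proof.
move=> q0 qx.
pose D t := \sum_s `|x s| * generator q s t.
have DE t : D t = \sum_(s | s != t) `|x s| * q s t
    - `|x t| * \sum_(u | u != t) q t u.
  rewrite /D (bigD1 t) //= {1}/generator eqxx mulrN addrC; congr (_ + _).
  by apply: eq_bigr => s st; rewrite /generator (negbTE st).
have D0 t : 0 <= D t.
  rewrite DE subr_ge0.
  have out0 : 0 <= \sum_(u | u != t) q t u by exact: sumr_ge0.
  rewrite -{1}(ger0_norm out0) -normrM.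
  have -> : x t * \sum_(u | u != t) q t u = \sum_(s | s != t) x s * q s t.
    apply/esym/eqP; rewrite -subr_eq0; apply/eqP; rewrite -[RHS](qx t).
    rewrite [RHS](bigD1 t) //= {1}/generator eqxx mulrN addrC; congr (_ + _).
    by apply: eq_bigr => s st; rewrite /generator (negbTE st).
  apply: le_trans (ler_norm_sum _ _ _) _; apply: ler_sum => s _.
  by rewrite normrM (ger0_norm (q0 _ _)).
have sumD : \sum_t D t = 0.
  rewrite /D exchange_big big1 //= => s _.
  by rewrite -mulr_sumr generator_row0 mulr0.
move=> t; have /eqP := sumD; rewrite psumr_eq0 // => /allP /(_ t).
rewrite mem_index_enum => /(_ isT) /eqP Dt0; rewrite -[RHS]Dt0.
by apply: eq_bigr => s _; rewrite ffunE.
Qed.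

Lemma stationary_eq0 q x t : (forall s t, 0 <= q s t) ->
  irreducible_rates q -> stationary q x -> (forall s, 0 <= x s) ->
  x t = 0 -> forall s, x s = 0.
Proof.
move=> q0 irr qx x0 xt s.
have step u v : 0 < q u v -> x v = 0 -> x u = 0.
  move=> quv xv; have [->//|uv] := eqVneq u v.
  have := qx v; rewrite (bigD1 v) //= xv mul0r add0r => /eqP.
  rewrite psumr_eq0; last first.
    by move=> w wv; rewrite mulr_ge0 // /generator (negbTE wv).
  move=> /allP /(_ u); rewrite mem_index_enum uv => /(_ isT) /=.
  by rewrite /generator (negbTE uv) mulf_eq0 (gt_eqF quv) orbF => /eqP.
have /connectP[r] := irr s t.
elim: r s => [|u r IHr] s /=; first by move=> _ <-.
by move=> /andP[qsu /IHr xu] /xu; exact: step.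
Qed.

Lemma invariant_distribution_unique q p p' : (forall s t, 0 <= q s t) ->
  irreducible_rates q -> invariant_distribution q p ->
  invariant_distribution q p' -> p = p'.
Proof.
move=> q0 irr [p0 p1 qp] [p'0 p'1 qp'].
pose d : {ffun T -> R} := [ffun s => p s - p' s].
have qd : stationary q d.
  move=> t; have /eqP := qp t; rewrite -[X in _ == X](qp' t) -subr_eq0.
  rewrite -sumrB => /eqP eqd; rewrite -[RHS]eqd.
  by apply: eq_bigr => s _; rewrite ffunE mulrBl.
have d1 : \sum_s d s = 0.
  under eq_bigr => s _ do rewrite ffunE.
  by rewrite sumrB p1 p'1 subrr.
pose e : {ffun T -> R} := [ffun s => `|d s| + d s].
have qe : stationary q e.
  move=> t; have nt := stationary_norm q0 qd t.
  under eq_bigr => s _ do rewrite ffunE mulrDl.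
  rewrite big_split /= qd addr0 -[RHS]nt.
  by apply: eq_bigr => s _; rewrite [in RHS]ffunE.
have e0 s : 0 <= e s by rewrite ffunE -lerBlDr sub0r -normrN ler_norm.
have [t dt] : exists t, d t <= 0.
  apply/not_existsP => dpos.
  have dgt0 s : 0 < d s by rewrite ltNge; apply/negP/dpos.
  have /eqP := d1; rewrite psumr_eq0; last by move=> s _; exact: ltW.
  move=> /allP d00.
  have : \sum_s p s = 0.
    apply: big1 => s _; have := d00 s; rewrite mem_index_enum => /(_ isT).
    by rewrite /= gt_eqF.
  by rewrite p1 => /eqP; rewrite oner_eq0.
have et : e t = 0 by rewrite ffunE ler0_norm // addNr.
have es := stationary_eq0 q0 irr qe e0 et.
have dle0 s : d s <= 0.
  have /eqP := es s; rewrite ffunE addr_eq0 => /eqP ds.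
  by rewrite -oppr_ge0 -ds.
apply/ffunP => s; apply/eqP; rewrite -subr_eq0.
have /eqP : \sum_s - d s = 0 by rewrite sumrN d1 oppr0.
rewrite psumr_eq0; last by move=> u _; rewrite oppr_ge0.
move=> /allP /(_ s); rewrite mem_index_enum => /(_ isT) /=.
by rewrite oppr_eq0 ffunE.
Qed.

Lemma invariant_distribution_exists q : (0 < #|T|)%N ->
  (forall s t, 0 <= q s t) -> exists p, invariant_distribution q p.
Proof.
move=> T0 q0; have [x qx [s xs]] := stationary_exists q T0.
have nx := stationary_norm q0 qx.
pose c := \sum_s `|x s|.
have c0 : 0 < c.
  rewrite lt_neqAle sumr_ge0 // andbT eq_sym psumr_eq0 //.
  apply/allPn; exists s; first exact: mem_index_enum.
  by rewrite /= normr_eq0.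
exists [ffun s => `|x s| / c]; split.
- by move=> t; rewrite ffunE divr_ge0 // ltW.
- under eq_bigr => t _ do rewrite ffunE.
  by rewrite -mulr_suml divff // gt_eqF.
- move=> t; transitivity (0 / c); last by rewrite mul0r.
  rewrite -[X in _ = X / _](nx t) mulr_suml.
  by apply: eq_bigr => u _; rewrite !ffunE mulrAC.
Qed.

Lemma invariant_lawP q : (0 < #|T|)%N -> (forall s t, 0 <= q s t) ->
  irreducible_rates q ->
  forall p, invariant_distribution q p <-> p = invariant_law q.
Proof.
move=> T0 q0 irr p; have [p0 qp0] := invariant_distribution_exists T0 q0.
have law : invariant_distribution q (invariant_law q).
  exact: (xgetPex [ffun=> 0] (ex_intro _ p0 qp0)).
by split=> [qp|->//]; exact: invariant_distribution_unique irr qp law.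
Qed.

End FiniteMarkovChain.

Section JoinShortestQueue.
Context {R : realType}.

Definition jsq_state (K : nat) : finType := ('I_K.+1 * 'I_K.+1)%type.

(* Arrival rate into a queue of length a when the other one has length b. *)
Definition arrival_rate (rho : R) (a b : nat) : R :=
  if (a < b)%N then 2 * rho else if a == b then rho else 0.

Definition queue_lengths (K : nat) (s : jsq_state K) : nat * nat :=
  (nat_of_ord s.1, nat_of_ord s.2).

(* Losses at (K, K), and the absence of service in an empty queue, come from
   the state space: the corresponding target lies outside it. *)
Definition jsq_rate (K : nat) (rho : R) (s t : jsq_state K) : R :=
  let: (a, b) := queue_lengths s in
  let: (c, d) := queue_lengths t in
  if (c == a.+1) && (d == b) then arrival_rate rho a b
  else if (c == a) && (d == b.+1) then arrival_rate rho b a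
  else if (a == c.+1) && (b == d) then 1
  else if (a == c) && (b == d.+1) then 1
  else 0.

Definition jsq_pi (K : nat) (rho : R) : {ffun jsq_state K -> R} :=
  invariant_law (@jsq_rate K rho).

Definition blocking_probability (K : nat) (rho : R) : R :=
  jsq_pi K rho (ord_max, ord_max).

Lemma jsq_rate_ge0 K (rho : R) : 0 < rho ->
  forall s t, 0 <= @jsq_rate K rho s t.
Proof.
move=> r0 [a b] [c d].
have ar m n : 0 <= arrival_rate rho m n.
  rewrite /arrival_rate; case: ifP => _; first by rewrite mulr_ge0 // ltW.
  by case: ifP => _ //; exact: ltW.
by rewrite /jsq_rate /=; do 4!case: ifP => _ //.
Qed.

Lemma jsq_rate_irreducible K (rho : R) : 0 < rho ->
  irreducible_rates (@jsq_rate K rho).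
Proof.
move=> r0.
pose e := [rel u v | 0 < @jsq_rate K rho u v].
pose st (a b : nat) : jsq_state K := (inord a, inord b).
have stE (u : jsq_state K) : u = st u.1 u.2.
  by case: u => a b; rewrite /st !inord_val.
have lens a b : (a <= K)%N -> (b <= K)%N -> queue_lengths (st a b) = (a, b).
  by move=> aK bK; rewrite /queue_lengths /= !inordK.
have nS n : (n == n.+1) = false by rewrite ltn_eqF.
have nS2 n : (n == n.+2) = false by rewrite ltn_eqF.
have dep1 a b : (a < K)%N -> (b <= K)%N -> e (st a.+1 b) (st a b).
  move=> aK bK; rewrite /e /= /jsq_rate !lens // 1?ltnW //.
  by rewrite nS2 nS !eqxx /=.
have dep2 a b : (a <= K)%N -> (b < K)%N -> e (st a b.+1) (st a b).
  move=> aK bK; rewrite /e /= /jsq_rate !lens // 1?ltnW //.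
  by rewrite !nS nS2 !eqxx /=.
have arr1 a : (a < K)%N -> e (st a a) (st a.+1 a).
  move=> aK; rewrite /e /= /jsq_rate !lens // 1?ltnW //.
  by rewrite !eqxx /= /arrival_rate ltnn eqxx.
have arr2 a : (a < K)%N -> e (st a.+1 a) (st a.+1 a.+1).
  move=> aK; rewrite /e /= /jsq_rate !lens // 1?ltnW //.
  by rewrite nS !eqxx /= /arrival_rate ltnSn mulr_gt0.
have down b : (b <= K)%N -> forall m a, (a + m <= K)%N ->
    connect e (st (a + m)%N b) (st a b).
  move=> bK; elim=> [|m IHm] a; first by rewrite addn0 => _; exact: connect0.
  rewrite addnS => amK.
  by apply: connect_trans (IHm a (ltnW amK)); exact/connect1/dep1.
have left a : (a <= K)%N -> forall m b, (b + m <= K)%N ->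
    connect e (st a (b + m)%N) (st a b).
  move=> aK; elim=> [|m IHm] b; first by rewrite addn0 => _; exact: connect0.
  rewrite addnS => bmK.
  by apply: connect_trans (IHm b (ltnW bmK)); exact/connect1/dep2.
have up m : (m <= K)%N -> connect e (st 0%N 0%N) (st m m).
  elim: m => [|m IHm] mK; first exact: connect0.
  apply: connect_trans (IHm (ltnW mK)) _.
  exact: connect_trans (connect1 (arr1 m mK)) (connect1 (arr2 m mK)).
move=> s t; rewrite (stE s) (stE t).
have [s1 s2] : (s.1 <= K)%N /\ (s.2 <= K)%N by split; rewrite -ltnS ltn_ord.
have [t1 t2] : (t.1 <= K)%N /\ (t.2 <= K)%N by split; rewrite -ltnS ltn_ord.
apply: (@connect_trans _ _ (st 0%N s.2)); first exact: (down _ s2 s.1 0%N).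
apply: (@connect_trans _ _ (st 0%N 0%N)); first exact: (left _ (leq0n K) s.2 0%N).
apply: connect_trans (up K (leqnn K)) _.
apply: (@connect_trans _ _ (st t.1 K)).
  by have := down K (leqnn K) (K - t.1)%N t.1; rewrite subnKC //; exact.
by have := left _ t1 (K - t.2)%N t.2; rewrite subnKC //; exact.
Qed.

Lemma jsq_piP K (rho : R) p : 0 < rho ->
  invariant_distribution (@jsq_rate K rho) p <-> p = jsq_pi K rho.
Proof.
move=> r0; apply: invariant_lawP.
- by apply/card_gt0P; exists (ord0, ord0).
- exact: jsq_rate_ge0.
- exact: jsq_rate_irreducible.
Qed.

End JoinShortestQueue.

(* Main.v *)
(* If L is the generator and f any function on the states, then
   sum_s pi(s) (L f)(s) = 0. For f a function of (j, k), the minimum and the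
   maximum of the two queue lengths, finite capacity only alters L f at (K, K).
   Hence a function f of constant drift alpha for the infinite-capacity chain
   gives pi(K, K) * 2 rho (f(K, K+1) - f(K, K)) = alpha. Such an f is obtained
   from exponentials x^j y^k annihilated by L off the boundary, that is with
   2 rho (x - 1) + (1/x - 1) + (1/y - 1) = 0: the solutions (1/(2 rho), 1),
   (1/2, 1/rho) and (1/rho, 1/rho) can be combined with j + k so that the
   drifts at j = 0 and on the diagonal also become constant. This yields
     pi(K, K) (rho^(-2K) + (1 - rho) (2 rho)^(-K) - rho (2 - rho))
       = (1 - rho) (2 - rho),
   from which all the expansions follow. At rho = 1 and rho = 2 this identity
   reads 0 = 0; there f is replaced by its derivative in rho. *)
Require Import Defs.
From mathcomp Require Import all_boot all_order all_algebra.
From mathcomp Require Import all_classical all_reals all_analysis.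
From mathcomp Require Import ring lra zify.
Import Order.TTheory GRing.Theory Num.Theory.
Import numFieldNormedType.Exports.
Local Open Scope classical_set_scope.
Local Open Scope ring_scope.

(** * Sums against the transition rates and the generator *)

(** The four transition patterns exclude one another, so the nested conditional is a sum and each
    direction can be summed separately. *)
Lemma jsq_rateE (R : realType) (K : nat) (rho : R) (s t : jsq_state K) :
  jsq_rate rho s t =
    (if (t.1 == s.1.+1 :> nat) && (t.2 == s.2 :> nat)
     then arrival_rate rho s.1 s.2 else 0)
  + (if (t.1 == s.1 :> nat) && (t.2 == s.2.+1 :> nat)
     then arrival_rate rho s.2 s.1 else 0)
  + (if (t.1.+1 == s.1 :> nat) && (t.2 == s.2 :> nat) then 1 else 0)
  + (if (t.1 == s.1 :> nat) && (t.2.+1 == s.2 :> nat) then 1 else 0).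
Proof.
rewrite /jsq_rate /queue_lengths.
case: s t => [[a ha] [b hb]] [[c hc] [d hd]] /=.
have nS m : (m == m.+1) = false by rewrite ltn_eqF.
have Sn m : (m.+1 == m) = false by rewrite gtn_eqF.
have SSn m : (m.+2 == m) = false by rewrite gtn_eqF.
rewrite (eq_sym a c.+1) (eq_sym b d) (eq_sym a c) (eq_sym b d.+1).
case: ifP => [/andP[/eqP -> /eqP ->]|_]; first by rewrite !Sn SSn /= !addr0.
case: ifP => [/andP[/eqP -> /eqP ->]|_]; first
  by rewrite !Sn SSn !andbF !addr0 add0r.
case: ifP => [/andP[/eqP <- /eqP ->]|_]; first by rewrite !nS /= addr0 !add0r.
by rewrite !add0r.
Qed.

Lemma sum_state_eq (R : realType) (K m n : nat) (x : R) (g : nat -> nat -> R) :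
  \sum_(t : jsq_state K)
     (if (t.1 == m :> nat) && (t.2 == n :> nat) then x else 0) * g t.1 t.2
  = if (m <= K)%N && (n <= K)%N then x * g m n else 0.
Proof.
have [/andP[mK nK]|mnK] := ifPn; last first.
  apply: big1 => t _; case: ifPn => [/andP[/eqP tm /eqP tn]|_]; rewrite ?mul0r //.
  by move: mnK; rewrite -tm -tn !leq_ord.
rewrite (bigD1 (inord m, inord n)) //= !inordK ?ltnS // !eqxx /= big1 ?addr0 //.
case=> c d /= cd; case: ifPn => [/andP[/eqP cm /eqP dn]|_]; rewrite ?mul0r //.
by move: cd; rewrite -cm -dn !inord_val eqxx.
Qed.

(** The diagonal entry is minus the exit rate, so the generator acts on increments of [F]; the term
    [t = s] vanishes. *)
Lemma sum_generatorE (R : realType) (K : nat) (rho : R) (s : jsq_state K)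
    (F : jsq_state K -> R) :
  \sum_t generator (jsq_rate rho) s t * F t
  = \sum_t jsq_rate rho s t * (F t - F s).
Proof.
rewrite (bigD1 s) //= [RHS](bigD1 s) //= subrr mulr0 add0r.
rewrite {1}/generator eqxx mulNr mulr_suml -sumrN -big_split /=.
by apply: eq_bigr => t /negbTE ts; rewrite /generator eq_sym ts mulrBr addrC.
Qed.

Lemma sum_jsq_rateE (R : realType) (K : nat) (rho : R) (s : jsq_state K)
    (g : nat -> nat -> R) :
  \sum_t jsq_rate rho s t * g t.1 t.2
  = (if (s.1 < K)%N then arrival_rate rho s.1 s.2 * g s.1.+1 s.2 else 0)
  + (if (s.2 < K)%N then arrival_rate rho s.2 s.1 * g s.1 s.2.+1 else 0)
  + (if (0 < s.1)%N then g s.1.-1 s.2 else 0)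
  + (if (0 < s.2)%N then g s.1 s.2.-1 else 0).
Proof.
under eq_bigr => t _ do rewrite jsq_rateE !mulrDl.
rewrite !big_split /=; case: s => [[a ha] [b hb]] /=.
have [aK bK] : (a <= K)%N /\ (b <= K)%N by [].
congr (_ + _ + _ + _); rewrite ?sum_state_eq ?aK ?bK ?andbT //.
- case: a ha aK => [|a] ha aK /=.
    by apply: big1 => t _; rewrite mul0r.
  under eq_bigr => t _ do rewrite eqSS.
  by rewrite sum_state_eq mul1r (ltnW aK) bK.
- case: b hb bK => [|b] hb bK /=.
    by apply: big1 => t _; rewrite andbF mul0r.
  under eq_bigr => t _ do rewrite eqSS.
  by rewrite sum_state_eq mul1r (ltnW bK) aK.
Qed.

(** * Drift identity and exact equations for the blocking probability *)

Lemma blocking_probability_drift (R : realType) (K : nat) (rho alpha : R)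
    (f : nat -> nat -> R) :
  0 < rho ->
  (forall j k, (j <= k)%N ->
     2 * rho * (f j.+1 k.+1 - f j k.+1)
     + (if (0 < j)%N then f j.-1 k.+1 - f j k.+1 else 0)
     + (f j k - f j k.+1) = alpha) ->
  (forall k,
     2 * rho * (f k k.+1 - f k k)
     + (if (0 < k)%N then 2 * (f k.-1 k - f k k) else 0) = alpha) ->
  blocking_probability K rho * (2 * rho * (f K K.+1 - f K K)) = alpha.
Proof.
move=> rho0 fjk fkk.
have [_ p1 pst] : invariant_distribution (@jsq_rate R K rho) (jsq_pi K rho).
  exact/jsq_piP.
rewrite /blocking_probability; set p := jsq_pi K rho in p1 pst *.
pose g a b := f (minn a b) (maxn a b).
(* [c] is the contribution of the arrivals lost at (K, K). *)
pose c := 2 * rho * (f K K.+1 - f K K).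
have gC a b : g a b = g b a by rewrite /g minnC maxnC.
have gle a b : (a <= b)%N -> g a b = f a b.
  by move=> ab; rewrite /g (minn_idPl ab) (maxn_idPr ab).
have drift (s : jsq_state K) :
    \sum_t generator (jsq_rate rho) s t * g t.1 t.2
    = alpha - (if s == (ord_max, ord_max) then c else 0).
  rewrite (sum_generatorE _ _ _ _ (fun t => g t.1 t.2)).
  rewrite (sum_jsq_rateE _ _ _ _ (fun a b => g a b - g s.1 s.2)).
  have -> : (s == (ord_max, ord_max)) = (s.1 == K :> nat) && (s.2 == K :> nat).
    by case: s => a b.
  have : (s.1 <= K)%N /\ (s.2 <= K)%N by rewrite !leq_ord.
  move: (nat_of_ord s.1) (nat_of_ord s.2) => {s} a b [].
  wlog ab : a b / (a <= b)%N => [H aK bK|].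
    have [|/ltnW ba] := leqP a b; first by move/H; exact.
    rewrite andbC -(H b a) // ![g b _]gC ![g _ a]gC /=.
    by rewrite -!addrA; ring.
  case: (ltngtP a b) ab => // [ab|->] _ aK bK.
  (* Off the diagonal, arrivals join the queue of length [a < b <= K], so capacity suppresses no
     transition. *)
  - rewrite (leq_trans ab bK) /arrival_rate ab (ltnNge b a) (ltnW ab) /=.
    rewrite (gtn_eqF ab) mul0r if_same addr0 (leq_ltn_trans _ ab) //.
    case: b ab bK => // b ab bK; rewrite !gle //=; try lia.
    by rewrite (ltn_eqF (leq_trans ab bK)) /= subr0 -(fjk a b) //.
  - rewrite /arrival_rate ltnn eqxx andbb.
    rewrite (gC b.+1 b) (gC b.-1 b) [in g b b.-1]gC !gle ?leq_pred //.
    rewrite -(fkk b) /c; case: (ltngtP b K) bK => // [_|->] _;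
    case: ifP => _; ring.
(* Stationarity is paired with [g]; exchanging the sums turns it into the mean of the drift under
   [p]. *)
have : \sum_t (\sum_s p s * generator (jsq_rate rho) s t) * g t.1 t.2 = 0.
  by apply: big1 => t _; rewrite pst mul0r.
under eq_bigr => t _ do rewrite mulr_suml.
rewrite exchange_big /=.
under eq_bigr => s _.
  under eq_bigr => t _ do rewrite -mulrA.
  rewrite -mulr_sumr drift mulrBr.
  over.
rewrite /= sumrB -mulr_suml p1 mul1r => /eqP; rewrite subr_eq0 => /eqP ->.
rewrite (bigD1 (ord_max, ord_max)) //= eqxx big1 ?addr0 // => s /negbTE ->.
by rewrite mulr0.
Qed.

(* The geometric sums are (x^n - 1) / (x - 1) for x = 1/rho and x = 1/(2 rho):
   subtracting constants from the exponentials keeps f defined at rho = 1 and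
   rho = 1/2. *)
Lemma blocking_probability_eq (R : realType) (K : nat) (rho : R) :
  0 < rho ->
  blocking_probability K rho
    * (rho ^- (2 * K) + (1 - rho) * (2 * rho) ^- K - rho * (2 - rho))
  = (1 - rho) * (2 - rho).
Proof.
move=> rho0; have rhoN0 : rho != 0 by rewrite gt_eqF.
pose f j k := 2^-1 ^+ j * rho^-1 ^+ k + \sum_(i < j + k) rho^-1 ^+ i.+1
  + (2 - rho) * (\sum_(i < j) (2^-1 * rho^-1) ^+ i.+1 - (j + k)%:R).
have /(blocking_probability_drift R K rho ((1 - rho) * (2 - rho) * 2) f rho0) :
    forall j k, (j <= k)%N ->
     2 * rho * (f j.+1 k.+1 - f j k.+1)
     + (if (0 < j)%N then f j.-1 k.+1 - f j k.+1 else 0)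
     + (f j k - f j k.+1) = (1 - rho) * (2 - rho) * 2.
  move=> [|j] k _; rewrite /f /= !(addSn, addnS, big_ord_recr) /= ?big_ord0;
    rewrite !(exprMn, exprS, exprD) ?expr0 /=;
    move: (\sum_(i < _) _) (rho^-1 ^+ k) => s u.
    by rewrite -!natr1; field.
  move: (\sum_(i < j) _) (rho^-1 ^+ j) (2^-1 ^+ j) => s' u' u''.
  by rewrite -!natr1 natrD; field.
have drift0 k : 2 * rho * (f k k.+1 - f k k)
     + (if (0 < k)%N then 2 * (f k.-1 k - f k k) else 0)
     = (1 - rho) * (2 - rho) * 2.
  case: k => [|k]; rewrite /f /= !(addSn, addnS, big_ord_recr) /= ?big_ord0;
    rewrite !(exprMn, exprS, exprD) ?expr0 /=.
    by rewrite -!natr1; field.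
  move: (\sum_(i < k + k) _) (\sum_(i < k) _) (rho^-1 ^+ k) (2^-1 ^+ k).
  by move=> s s' u u'; rewrite -!natr1 natrD; field.
move=> /(_ drift0) eq_alpha.
(* [2 * rho * (f K K.+1 - f K K)] is twice the bracket of the statement, whence the factor 2 in the
   drift. *)
apply: (mulIf (_ : 2 != 0)); first by rewrite pnatr_eq0.
rewrite -[RHS]eq_alpha /f addnS big_ord_recr /= mulnC exprM [in LHS]expr2.
rewrite !exprS exprD -!exprVn !invfM !exprMn -!exprVn.
move: (\sum_(i < _) _) (\sum_(i < _) _) (rho^-1 ^+ K) (2^-1 ^+ K) => s s' u u'.
by rewrite -natr1 natrD; field.
Qed.

(* f is, up to constants, the rho-derivative at rho = 1 of the function used in
   blocking_probability_eq. *)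
Lemma blocking_probability_eq1 (R : realType) (K : nat) :
  blocking_probability K (1 : R) * (2 * K%:R + 2 ^- K) = 1.
Proof.
pose f j k : R := (j%:R - k%:R + 3) * 2^-1 ^+ j
  - (j + k)%:R * ((j + k)%:R - 1) / 2.
have /(blocking_probability_drift R K 1 (- 2) f ltr01) :
    forall j k, (j <= k)%N ->
     2 * 1 * (f j.+1 k.+1 - f j k.+1)
     + (if (0 < j)%N then f j.-1 k.+1 - f j k.+1 else 0)
     + (f j k - f j k.+1) = - 2.
  move=> [|j] k _; rewrite /f /= !(addSn, addnS) ?exprS ?expr0.
    by rewrite -!natr1; field.
  by move: (2^-1 ^+ j) => u; rewrite -!natr1 natrD; field.
have drift0 k : 2 * 1 * (f k k.+1 - f k k)
     + (if (0 < k)%N then 2 * (f k.-1 k - f k k) else 0) = - 2.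
  case: k => [|k]; rewrite /f /= !(addSn, addnS) ?exprS ?expr0.
    by rewrite -!natr1; field.
  by move: (2^-1 ^+ k) => u; rewrite -!natr1 natrD; field.
move=> /(_ drift0) eq_alpha.
apply: (mulIf (_ : - 2 != 0)); first by rewrite oppr_eq0 pnatr_eq0.
rewrite mul1r -[RHS]eq_alpha /f addnS -!exprVn.
by move: (2^-1 ^+ K) => u; rewrite -!natr1 natrD; field.
Qed.

(* f is, up to constants, the rho-derivative at rho = 2 of the function used in
   blocking_probability_eq. *)
Lemma blocking_probability_eq2 (R : realType) (K : nat) :
  blocking_probability K (2 : R) * (4 - (K%:R + 2) * 2 ^- (2 * K)) = 2.
Proof.
pose f j k : R := (j%:R + 2) / 2 * 2^-1 ^+ (j + k) + (j + k)%:R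
  + 2^-1 ^+ (j + j) / 3.
have /(blocking_probability_drift R K 2 2 f (ltr0Sn _ _)) :
    forall j k, (j <= k)%N ->
     2 * 2 * (f j.+1 k.+1 - f j k.+1)
     + (if (0 < j)%N then f j.-1 k.+1 - f j k.+1 else 0)
     + (f j k - f j k.+1) = 2.
  move=> [|j] k _;
    rewrite /f /= !(addSn, addnS) ?(exprS, exprD) ?expr0.
    by move: (2^-1 ^+ k) => u; rewrite -!natr1; field.
  by move: (2^-1 ^+ j) (2^-1 ^+ k) => u u'; rewrite -!natr1 natrD; field.
have drift0 k : 2 * 2 * (f k k.+1 - f k k)
     + (if (0 < k)%N then 2 * (f k.-1 k - f k k) else 0) = 2.
  case: k => [|k];
    rewrite /f /= !(addSn, addnS) ?(exprS, exprD) ?expr0.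
    by rewrite -!natr1; field.
  by move: (2^-1 ^+ k) => u; rewrite -!natr1 natrD; field.
move=> /(_ drift0) eq_alpha.
rewrite -[RHS]eq_alpha /f addnS exprS exprD mulnC exprM [in LHS]expr2.
rewrite invfM -exprVn.
by move: (2^-1 ^+ K) => u; rewrite -!natr1 natrD; field.
Qed.

(** * Explicit error bounds *)

Lemma eqaddO_near (T : Type) (R : realType) (F : filter_on T)
    (f g h : T -> R) (k : R) : 0 < k ->
  (\forall x \near F, `|f x - g x| <= k * `|h x|) ->
  f = g +O_F h.
Proof. by move=> k0 fgh; apply/eqaddOP/bigO_exP; exists k. Qed.

(** Multiplied by rho^(2K), the exact equation reads [P * E] = main term, with [E] close to 1. The
    bound is uniform in [K] and [rho], so it serves both limits. *)
Lemma blocking_probability_lt1 (R : realType) (K : nat) (rho : R) :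
  0 < rho < 1 ->
  `|blocking_probability K rho - rho ^+ (2 * K) * (1 - rho) * (2 - rho)|
  <= (2 - rho) / (1 - rho) * (rho ^+ (2 * K) * ((rho / 2) ^+ K + rho ^+ (2 * K))).
Proof.
move=> /andP[rho0 rho1]; have := blocking_probability_eq R K rho rho0.
rewrite mulnC exprM; set P := blocking_probability _ _.
have -> : (2 * rho) ^- K = (rho / 2) ^+ K / rho ^+ K ^+ 2.
  rewrite -exprM mulnC exprM -!exprVn -exprMn.
  by congr (_ ^+ _); field; rewrite gt_eqF.
have u0 : 0 < rho ^+ K by rewrite exprn_gt0.
have u1 : rho ^+ K <= 1 by rewrite exprn_ile1 ?ltW.
have w0 : 0 < (rho / 2) ^+ K by rewrite exprn_gt0 // divr_gt0.
move: (rho ^+ K) ((rho / 2) ^+ K) u0 u1 w0 => u w u0 u1 w0.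
pose E := 1 + (1 - rho) * w - rho * (2 - rho) * u ^+ 2.
have uN0 : u != 0 by rewrite gt_eqF.
have uu0 : 0 < u ^+ 2 by rewrite exprn_gt0.
have uu1 : u ^+ 2 <= 1 by rewrite exprn_ile1 // ltW.
move=> PE.
have {}PE : P * E = u ^+ 2 * (1 - rho) * (2 - rho).
  by rewrite -mulrA -PE /E; field.
have r1 : 0 < 1 - rho by rewrite subr_gt0.
have r2 : 0 < rho * (2 - rho) <= 1 by apply/andP; split; nra.
have w1 : 0 < (1 - rho) * w <= w by apply/andP; split; nra.
have u1' : 0 < rho * (2 - rho) * u ^+ 2 <= u ^+ 2 by apply/andP; split; nra.
(* Here [rho * (2 - rho)] is 1 - (1 - rho)^2 and [u ^+ 2 <= 1]. *)
have EN : (1 - rho) ^+ 2 <= E by rewrite /E; nra.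
have E0 : 0 < E by apply: lt_le_trans EN; rewrite exprn_gt0 // subr_gt0.
have E1 : `|1 - E| <= w + u ^+ 2.
  by rewrite /E ler_norml; apply/andP; split; lra.
have errE : (P - u ^+ 2 * (1 - rho) * (2 - rho)) * E
    = u ^+ 2 * (1 - rho) * (2 - rho) * (1 - E).
  by rewrite mulrBl PE; ring.
have c0 : 0 < u ^+ 2 * (1 - rho) * (2 - rho).
  by rewrite !mulr_gt0 ?subr_gt0 // (lt_trans rho1) ?ltr1n.
set err := `|_ - _|.
have {}errE : err * E = u ^+ 2 * (1 - rho) * (2 - rho) * `|1 - E|.
  by rewrite -{1}(gtr0_norm E0) -normrM errE normrM (gtr0_norm c0).
have err0 : 0 <= err by exact: normr_ge0.
rewrite mulrAC ler_pdivlMr //.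
rewrite -(ler_pM2r r1) -mulrA -expr2.
apply: (le_trans (ler_wpM2l err0 EN)); rewrite errE.
apply: (le_trans (ler_wpM2l (ltW c0) E1)).
by rewrite le_eqVlt; apply/orP; left; apply/eqP; ring.
Qed.

(** The bracket of the exact equation is [rho * (rho - 2) + e], and without [e] the equation would
    give 1 - 1/rho. The product form avoids a division: the bracket is 0 at rho = 2. *)
Lemma blocking_probability_gt1 (R : realType) (K : nat) (rho : R) :
  1 < rho ->
  let e := rho ^- (2 * K) + (1 - rho) * (2 * rho) ^- K in
  `|blocking_probability K rho - (1 - rho^-1)| * `|rho * (rho - 2) + e| <= `|e|.
Proof.
move=> rho1 /=; set e := rho ^- _ + _.
have rho0 : 0 < rho by exact: lt_trans rho1.
have := blocking_probability_eq R K rho rho0; rewrite -/e.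
set P := blocking_probability _ _ => PE.
have errE : (P - (1 - rho^-1)) * (rho * (rho - 2) + e) = - ((1 - rho^-1) * e).
  transitivity (P * (e - rho * (2 - rho))
     - (1 - rho^-1) * (rho * (rho - 2) + e)); first by ring.
  by rewrite PE; field; rewrite gt_eqF.
rewrite -normrM errE normrN normrM ler_piMl //.
have r1 : 0 < rho^-1 < 1 by rewrite invr_gt0 rho0 invf_lt1.
by rewrite ger0_norm; lra.
Qed.

(** * Large K at fixed rho *)

(** The two error terms decay like (rho^3/2)^K and rho^(4K); [q] dominates both rates, whose order
    switches at rho = 1/2. *)
Lemma blocking_probability_lt1_cvg (R : realType) (rho q : R) :
  0 < rho < 1 -> rho ^+ 3 / 2 <= q -> rho ^+ 4 <= q ->
  (fun K : nat => blocking_probability K rho)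
  = (fun K : nat => (rho ^+ (2 * K) * (1 - rho) * (2 - rho) : R)%R)
    +O_\oo (fun K : nat => (q ^+ K : R)%R).
Proof.
move=> rho01 q1 q2; have /andP[rho0 rho1] := rho01.
have rN0 : 0 < 1 - rho by rewrite subr_gt0.
have c0 : 0 < (2 - rho) / (1 - rho).
  by rewrite divr_gt0 // subr_gt0 (lt_trans rho1) // ltr1n.
have q0 : 0 < q by apply: lt_le_trans q2; rewrite exprn_gt0.
apply: (@eqaddO_near _ _ _ _ _ _ ((2 - rho) / (1 - rho) * 2)).
  by rewrite mulr_gt0.
have {}q1 : rho ^+ 2 * (rho / 2) <= q by rewrite mulrA -exprSr.
have {}q2 : rho ^+ 2 * rho ^+ 2 <= q by rewrite -exprD.
near=> K; apply: (le_trans (blocking_probability_lt1 _ _ _ rho01)).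
rewrite -[leRHS]mulrA ler_pM2l // gtr0_norm ?exprn_gt0 //.
rewrite mulrDr mulr_natl mulr2n exprM -!(exprMn K) lerD //.
  by rewrite lerXn2r // nnegrE ?(ltW q0) // mulr_ge0 ?exprn_ge0 ?divr_ge0 // ltW.
by rewrite lerXn2r // nnegrE ?(ltW q0) // mulr_ge0 ?exprn_ge0 // ltW.
Unshelve. all: by end_near. Qed.

(** [q] dominates the rates of the two terms of [e], whose order switches at rho = 2, where the
    limit [rho * (rho - 2)] of the bracket vanishes. *)
Lemma blocking_probability_gt1_cvg (R : realType) (rho q : R) :
  1 < rho -> rho != 2 -> rho ^- 2 <= q -> (2 * rho)^-1 <= q -> q < 1 ->
  (fun K : nat => blocking_probability K rho)
  = (fun K : nat => (1 - rho^-1 : R)%R) +O_\oo (fun K : nat => (q ^+ K : R)%R).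
Proof.
move=> rho1 rhoN2 q1 q2 qlt1; have rho0 : 0 < rho by exact: lt_trans rho1.
pose e K := rho ^- (2 * K) + (1 - rho) * (2 * rho) ^- K.
pose d := `|rho * (rho - 2)|.
have d0 : 0 < d by rewrite normr_gt0 mulf_neq0 ?subr_eq0 // gt_eqF.
have q0 : 0 < q by apply: lt_le_trans q1; rewrite invr_gt0 exprn_gt0.
have eK K : `|e K| <= rho * q ^+ K.
  have a1 : 0 < rho ^- (2 * K) <= q ^+ K.
    rewrite invr_gt0 exprn_gt0 //= exprM -exprVn.
    by rewrite lerXn2r // nnegrE ?invr_ge0 ?exprn_ge0 ?ltW.
  have a2 : 0 < (2 * rho) ^- K <= q ^+ K.
    rewrite invr_gt0 exprn_gt0 ?mulr_gt0 //= -exprVn.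
    by rewrite lerXn2r // nnegrE ?invr_ge0 ?mulr_ge0 ?ltW.
  by rewrite /e ler_norml; apply/andP; split; nra.
have cvgq : (fun K => rho * q ^+ K) @ \oo --> (0 : R).
  rewrite -[X in _ --> X](mulr0 rho); apply: cvgMr.
  by apply: cvg_expr; rewrite gtr0_norm.
apply: (@eqaddO_near _ _ _ _ _ _ (2 * rho / d)).
  by rewrite divr_gt0 // mulr_gt0.
near=> K.
(* Eventually [e] is at most half the limit of the bracket, which leaves a denominator of at least
   [d / 2]. *)
have small : rho * q ^+ K <= d / 2.
  near: K; apply: (cvgr_le _ cvgq); exact: divr_gt0.
have := blocking_probability_gt1 R K rho rho1; rewrite /= -/(e K).
have : d / 2 <= `|rho * (rho - 2) + e K|.
  have := lerB_normD (rho * (rho - 2)) (e K); rewrite -/d.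
  have := eK K; lra.
rewrite [`|q ^+ K|]gtr0_norm ?exprn_gt0 //.
have := eK K; have := normr_ge0 (blocking_probability K rho - (1 - rho^-1)).
move: `|e K| `|rho * _ + _| `|_ - _| => eps D err err0 epsK dD errD.
rewrite mulrAC ler_pdivlMr //; nra.
Unshelve. all: by end_near. Qed.

(** * Light and heavy traffic at fixed K *)

(** The constant 6 is 3 + 3: one part bounds the error at rho <= 1/2, the other comes from replacing
    (1 - rho)(2 - rho) by 2, a change of rho(3 - rho). *)
Lemma blocking_probability_light_traffic (R : realType) (K : nat) :
  (1 <= K)%N ->
  (fun rho : R => blocking_probability K rho)
  = (fun rho : R => (2 * rho ^+ (2 * K) : R)%R)
    +O_ ((0 : R)^'+) (fun rho : R => (rho ^+ (2 * K + 1) : R)%R).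
Proof.
move=> K1; apply: (@eqaddO_near _ _ _ _ _ _ 6) => //.
near=> rho.
have rho0 : 0 < rho by [].
have rhoh : rho <= 1 / 2 by near: rho; apply: nbhs_right_le.
have rho01 : 0 < rho < 1 by rewrite rho0; lra.
have up0 : 0 < rho ^+ (2 * K) by rewrite exprn_gt0.
rewrite addn1 exprSr [X in _ <= _ * X]gtr0_norm ?mulr_gt0 //.
have := blocking_probability_lt1 R K rho rho01.
have wp0 : 0 < (rho / 2) ^+ K by rewrite exprn_gt0 ?divr_gt0.
have wle : (rho / 2) ^+ K <= rho / 2.
  rewrite -[leRHS]expr1 ler_wiXn2l ?divr_ge0 ?(ltW rho0) //; lra.
have ule : rho ^+ (2 * K) <= rho / 2.
  have : rho ^+ (2 * K) <= rho ^+ 2.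
    by rewrite ler_wiXn2l ?(ltW rho0) //; [lra | lia].
  by rewrite expr2; nra.
have cle : 0 <= (2 - rho) / (1 - rho) <= 3.
  by rewrite divr_ge0 ?ler_pdivrMr /=; lra.
move: (blocking_probability _ _) (rho ^+ (2 * K)) ((rho / 2) ^+ K)
  ((2 - rho) / (1 - rho)) up0 wp0 wle ule cle => P u w c u0 w0 wle ule cle errP.
have {}errP : `|P - u * (1 - rho) * (2 - rho)| <= 3 * (u * rho).
  apply: (le_trans errP); apply: ler_pM; [lra | nra | lra | nra].
have -> : P - 2 * u = (P - u * (1 - rho) * (2 - rho)) - u * (rho * (3 - rho)).
  ring.
have : `|u * (rho * (3 - rho))| <= 3 * (u * rho).
  by rewrite ger0_norm; [nra | rewrite !mulr_ge0; lra].
have := ler_normB (P - u * (1 - rho) * (2 - rho)) (u * (rho * (3 - rho))).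
lra.
Unshelve. all: by end_near. Qed.

(** For rho >= 4, [e] is at most 2 rho^(1-K) in absolute value and the bracket at least rho^2/4; the
    constant 8 is their ratio. *)
Lemma blocking_probability_heavy_traffic (R : realType) (K : nat) :
  (1 <= K)%N ->
  (fun rho : R => blocking_probability K rho)
  = (fun rho : R => (1 - rho^-1 : R)%R)
    +O_ (+oo%R : set_system R) (fun rho : R => (rho ^- (K + 1) : R)%R).
Proof.
move=> K1; apply: (@eqaddO_near _ _ _ _ _ _ 8) => //.
near=> rho.
have rho4 : 4 <= rho by near: rho; apply: nbhs_pinfty_ge; rewrite num_real.
have rho0 : 0 < rho by lra.
have rho1 : 1 < rho by lra.
rewrite addn1 exprSr invfM [X in _ <= _ * X]gtr0_norm; last first.
  by rewrite mulr_gt0 ?invr_gt0 ?exprn_gt0.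
have /= := blocking_probability_gt1 R K rho rho1.
set e := rho ^- _ + _.
have v0 : 0 < rho ^- K by rewrite invr_gt0 exprn_gt0.
have w0 : 0 < (2 * rho) ^- K by rewrite invr_gt0 exprn_gt0 // mulr_gt0.
have vle : rho ^- (2 * K) <= rho ^- K.
  rewrite lef_pV2 ?posrE ?exprn_gt0 // ler_eXn2l //; lia.
have wle : (2 * rho) ^- K <= rho ^- K.
  by rewrite lef_pV2 ?posrE ?exprn_gt0 ?mulr_gt0 // lerXn2r ?nnegrE //; lra.
(* Since [1 <= K], the negative part of [e] stays bounded as rho grows. *)
have wle' : (2 * rho) ^- K * rho <= 1 / 2.
  have : (2 * rho) ^- K <= (2 * rho)^-1.
    rewrite lef_pV2 ?posrE ?exprn_gt0 ?mulr_gt0 // -[leLHS]expr1.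
    by rewrite ler_weXn2l //; lra.
  move=> /(ler_wpM2r (ltW rho0)) /le_trans; apply.
  by rewrite le_eqVlt; apply/orP; left; apply/eqP; field; rewrite gt_eqF.
have u0 : 0 < rho ^- (2 * K) by rewrite invr_gt0 exprn_gt0.
have eD : rho ^+ 2 / 4 <= rho * (rho - 2) + e by rewrite /e; nra.
have eN : `|e| <= 2 * (rho * rho ^- K) by rewrite /e ler_norml; apply/andP; split; nra.
have D0 : 0 <= rho * (rho - 2) + e by apply: le_trans eD; rewrite mulr_ge0 ?sqr_ge0.
rewrite (ger0_norm D0).
have := normr_ge0 (blocking_probability K rho - (1 - rho^-1)).
move: `|_ - _| => err err0 errD.
rewrite -(ler_pM2r (_ : 0 < rho ^+ 2 / 4)); last by rewrite divr_gt0 ?exprn_gt0.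
apply: (le_trans (ler_wpM2l err0 eD)); apply: (le_trans errD).
apply: (le_trans eN); rewrite le_eqVlt; apply/orP; left; apply/eqP.
by field; rewrite !gt_eqF ?exprn_gt0.
Unshelve. all: by end_near. Qed.

(** * The degenerate parameters rho = 1 and rho = 2 *)

Lemma blocking_probability_critical (R : realType) :
  (fun K : nat => blocking_probability K (1 : R))
  = (fun K : nat => ((2 * K%:R)^-1 : R)%R)
    +O_\oo (fun K : nat => (K%:R ^- 2 * 2 ^- K : R)%R).
Proof.
apply: (@eqaddO_near _ _ _ _ _ _ 1) => //.
near=> K.
have K0 : (0 < K)%N by near: K; exact: nbhs_infty_gt.
have n0 : (0 : R) < K%:R by rewrite ltr0n.
have w0 : (0 : R) < 2 ^- K by rewrite invr_gt0 exprn_gt0.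
have PE := blocking_probability_eq1 R K.
have D0 : 0 < 2 * K%:R + 2 ^- K :> R by rewrite addr_gt0 ?mulr_gt0.
have {PE} -> : blocking_probability K (1 : R) = (2 * K%:R + 2 ^- K)^-1.
  by apply: (mulIf (lt0r_neq0 D0)); rewrite PE mulVf ?lt0r_neq0.
move: (K%:R : R) (2 ^- K : R) n0 w0 D0 => n w n0 w0 D0.
(* The denominator on the right is at least [n ^+ 2], so the constant 1 suffices. *)
have -> : (2 * n + w)^-1 - (2 * n)^-1 = - (w / (2 * n * (2 * n + w))).
  by field; rewrite !lt0r_neq0.
rewrite normrN !gtr0_norm ?mulr_gt0 ?invr_gt0 ?exprn_gt0 ?mulr_gt0 //.
rewrite mul1r mulrC ler_pM2r // lef_pV2 ?posrE ?exprn_gt0 ?mulr_gt0 //; nra.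
Unshelve. all: by end_near. Qed.

Lemma blocking_probability_double (R : realType) :
  (fun K : nat => blocking_probability K (2 : R))
  = (fun K : nat => (1 / 2 : R)%R)
    +O_\oo (fun K : nat => (K%:R * 2 ^- (2 * K) : R)%R).
Proof.
apply: (@eqaddO_near _ _ _ _ _ _ 1) => //.
near=> K.
have K0 : (0 < K)%N by near: K; exact: nbhs_infty_gt.
have PE := blocking_probability_eq2 R K.
have w0 : (0 : R) < 2 ^- (2 * K) by rewrite invr_gt0 exprn_gt0.
(* This is K + 2 <= 4^K, which needs K >= 1; it keeps the factor in the exact equation at least
   3. *)
have nw : (K%:R + 2) * 2 ^- (2 * K) <= 1 :> R.
  rewrite ler_pdivrMr ?exprn_gt0 // mul1r -natrD -natrX ler_nat expnM.
  by elim: (K) K0 => // -[|k] // IH _; rewrite expnS; have := IH isT; lia.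
have n1 : 1 <= K%:R :> R by rewrite ler1n.
move: (blocking_probability _ _) (K%:R : R) (2 ^- (2 * K) : R) PE w0 nw n1.
move=> P n w PE w0 nw n1.
rewrite [X in _ <= _ * X]gtr0_norm; last by rewrite mulr_gt0 //; lra.
have D0 : 3 <= 4 - (n + 2) * w by lra.
have errE : (P - 1 / 2) * (4 - (n + 2) * w) = (n + 2) * w / 2.
  by rewrite mulrBl PE; field.
have nw3 : (n + 2) * w <= 3 * (n * w) by nra.
have nw0 : 0 < n * w by rewrite mulr_gt0 //; lra.
have err0 : 0 <= P - 1 / 2 by nra.
rewrite ger0_norm //; nra.
Unshelve. all: by end_near. Qed.

(** * Assembly of the regimes *)

Theorem proposition1 (R : realType) :
  (forall K : nat, (1 <= K)%N ->
     ((fun rho : R => blocking_probability K rho)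
        = (fun rho : R => (2 * rho ^+ (2 * K) : R)%R)
          +O_ ((0 : R)^'+) (fun rho : R => (rho ^+ (2 * K + 1) : R)%R))
     /\
     ((fun rho : R => blocking_probability K rho)
        = (fun rho : R => (1 - rho^-1 : R)%R)
          +O_ (+oo%R : set_system R) (fun rho : R => (rho ^- (K + 1) : R)%R)))
  /\
  (forall rho : R, 0 < rho ->
     [/\ rho < 1 / 2 ->
           (fun K : nat => blocking_probability K rho)
             = (fun K : nat => (rho ^+ (2 * K) * (1 - rho) * (2 - rho) : R)%R)
               +O_\oo (fun K : nat => ((rho ^+ 3 / 2) ^+ K : R)%R),
         1 / 2 <= rho < 1 ->
           (fun K : nat => blocking_probability K rho)
             = (fun K : nat => (rho ^+ (2 * K) * (1 - rho) * (2 - rho) : R)%R)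
               +O_\oo (fun K : nat => (rho ^+ (4 * K) : R)%R)
       & rho = 1 ->
           (fun K : nat => blocking_probability K rho)
             = (fun K : nat => ((2 * K%:R)^-1 : R)%R)
               +O_\oo (fun K : nat => (K%:R ^- 2 * 2 ^- K : R)%R)]
     /\
     [/\ 1 < rho < 2 ->
           (fun K : nat => blocking_probability K rho)
             = (fun K : nat => (1 - rho^-1 : R)%R)
               +O_\oo (fun K : nat => (rho ^- (2 * K) : R)%R),
         rho = 2 ->
           (fun K : nat => blocking_probability K rho)
             = (fun K : nat => (1 / 2 : R)%R)
               +O_\oo (fun K : nat => (K%:R * 2 ^- (2 * K) : R)%R)
       & 2 < rho ->
           (fun K : nat => blocking_probability K rho)
             = (fun K : nat => (1 - rho^-1 : R)%R)
               +O_\oo (fun K : nat => ((2 * rho) ^- K : R)%R)]).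
Proof.
split=> [K K1|rho rho0].
  split; first exact: blocking_probability_light_traffic.
  exact: blocking_probability_heavy_traffic.
(* The error gauges are put in the form [q ^+ K], with [q] the larger of the two rates in each
   regime. *)
have exprMK (x : R) m : (fun K : nat => x ^+ (m * K)) = (fun K => (x ^+ m) ^+ K).
  by apply/funext => K; rewrite exprM.
have exprVMK (x : R) m : (fun K : nat => x ^- (m * K)) = (fun K => (x ^- m) ^+ K).
  by apply/funext => K; rewrite exprM exprVn.
split; split.
- move=> rho1; apply: blocking_probability_lt1_cvg => //; first by rewrite rho0; lra.
  by rewrite exprSr ler_wpM2l ?exprn_ge0; lra.
- move=> /andP[rho1 rho2]; rewrite exprMK.
  apply: blocking_probability_lt1_cvg => //; first by rewrite rho0.
  by rewrite [leRHS]exprSr ler_wpM2l ?exprn_ge0; lra.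
- by move=> ->; exact: blocking_probability_critical.
- move=> /andP[rho1 rho2]; rewrite exprVMK.
  apply: blocking_probability_gt1_cvg => //; first by rewrite lt_eqF.
    by rewrite lef_pV2 ?posrE ?exprn_gt0 ?mulr_gt0 // expr2 ler_wpM2r //; lra.
  by rewrite invf_lt1 ?exprn_gt0 // exprn_egt1.
- by move=> ->; exact: blocking_probability_double.
- move=> rho2.
  have -> : (fun K : nat => (2 * rho) ^- K) = (fun K => ((2 * rho)^-1) ^+ K).
    by apply/funext => K; rewrite exprVn.
  apply: blocking_probability_gt1_cvg => //; first by lra.
  - by rewrite gt_eqF.
  - by rewrite lef_pV2 ?posrE ?exprn_gt0 ?mulr_gt0 // expr2 ler_wpM2r; lra.
  - by rewrite invf_lt1; lra.
Qed.
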